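(* For $n=2$, the triangle formed by $\tilde\psi_2 : C^{\mathrm{grp}}_\bullet(2)\to Z^2(k,\bullet)_{\mathbb{Q}}$, $\mathrm{reg}_B : C^{\mathrm{grp}}_\bullet(2)\to \mathbb{R}[3]$ and $\mathrm{reg}_G : Z^2(k,\bullet)_{\mathbb{Q}}\to\mathbb{R}[3]$ does not commute (in general); that is, $\mathrm{reg}_G\circ\tilde\psi_2\neq \mathrm{reg}_B$. Explicitly: there exist a number field $k$, an embedding $\sigma:k\hookrightarrow\mathbb{C}$, a nonzero vector $\underline{v}\in k^2$, and a tuple $(g_0,g_1,g_2,g_3)\in GL_2(k)^4$ such that the vectors $g_0\underline v,\ldots,g_3\underline v$ are pairwise linearly independent, $\mathrm{reg}_G$ is defined on $Y=\tilde\psi_2(g_0,g_1,g_2,g_3)$, and $$\mathrm{reg}_G\big(\tilde\psi_2(g_0,g_1,g_2,g_3)\big)\;\neq\;\mathrm{reg}_B(g_0,g_1,g_2,g_3).$$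
   Context: Let $k$ be a number field with an embedding $\sigma:k\hookrightarrow\mathbb{C}$ (used to regard elements of $k$ as complex numbers), and fix a nonzero column vector $\underline v\in k^2$. **Simplices and cycles.** $\Delta^m=\mathbb{P}^m_k\setminus H$ with homogeneous coordinates $x_0,\ldots,x_m$ and $H=\{x_0+\cdots+x_m=0\}$. $Z^2(k,m)$ is the free abelian group on closed irreducible codimension-2 subvarieties of $\Delta^m$ meeting properly every face (a face is given by $x_i=0$ for all $i\in I$). The boundary is the alternating sum of restrictions to the facets $x_i=0$. Write $Z^2(k,m)_{\mathbb{Q}}=Z^2(k,m)\otimes\mathbb{Q}$. **Group chains and the map $\tilde\psi_2$.** $C^{\mathrm{grp}}_m(2)$ denotes (homogeneous, rational) group homology chains for $GL_2(k)$, generated by tuples $(g_0,\ldots,g_m)$ with $g_i\in GL_2(k)$, modulo simultaneous left multiplication, where the vectors $g_i\underline v$ are taken in general position (pairwise linearly independent), so that the cycle below meets faces properly. The map $\tilde\psi_2$ sends $(g_0,\ldots,g_m)$ to the linear cycle $$\Big\{\sum_{i=0}^m x_i\, g_i\underline v=0\Big\}\subset\Delta^m .$$ **The integral of $r_3$.** For nonzero rational functions $f_1,f_2,f_3$ on a smooth projective complex curve $C$ (here always $C\cong\mathbb{P}^1_{\mathbb{C}}$ with its complex orientation), $r_3(f_1,f_2,f_3)$ is Goncharov's 2-form. On a curve its integral equals $$\int_C r_3(f_1,f_2,f_3)=\kappa\int_C \log|f_1|\; d\log|f_2|\wedge d\log|f_3|,$$ where $\kappa$ is a universal nonzero real constant.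 It is normalized so that, on $\mathbb{P}^1$, $$\int_{\mathbb{P}^1} r_3(f_1,f_2,f_3)=\sum_{(y_1,y_2,y_3)\in\mathbb{C}^3}\nu_{y_1}(f_1)\,\nu_{y_2}(f_2)\,\nu_{y_3}(f_3)\,D_2\big(\mathsf{CR}(y_1,y_2,y_3,\infty)\big).$$ Here $\nu_y(f)$ is the order of $f$ at $y$, $\mathsf{CR}$ is the cross-ratio with $\mathsf{CR}(y_1,y_2,y_3,\infty)=\frac{y_1-y_3}{y_1-y_2}$ (terms in which two or more of the $y_i$ coincide contribute $0$), and $D_2(z)=\mathrm{Im}(\mathrm{Li}_2(z))+\arg(1-z)\log|z|$ is the Bloch–Wigner function, with $D_2(0)=D_2(1)=D_2(\infty)=0$. The same $\kappa$ is used in both maps below. The integral is unchanged when any $f_i$ is multiplied by a nonzero constant. **The map $\mathrm{reg}_B$.** For a tuple $(g_0,g_1,g_2,g_3)$ with $g_i\in GL_2(k)$ such that the vectors $g_0\underline v,\ldots,g_3\underline v$ are pairwise linearly independent, let $[X_0:X_1]$ be homogeneous coordinates on $\mathbb{P}^1_{\mathbb{C}}$, and for $i=1,2,3$ let $f_i$ be a nonzero rational function on $\mathbb{P}^1_{\mathbb{C}}$ with divisor $$\{(X_0,X_1)\cdot g_i\underline v=0\}-\{(X_0,X_1)\cdot g_0\underline v=0\},$$ that is, up to a constant, $f_i=\frac{(X_0,X_1)\cdot g_i\underline v}{(X_0,X_1)\cdot g_0\underline v}$. Then $$\mathrm{reg}_B(g_0,g_1,g_2,g_3):=\int_{\mathbb{P}^1_{\mathbb{C}}}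 r_3(f_1,f_2,f_3).$$ **The map $\mathrm{reg}_G$.** For a curve $Y\in Z^2(k,3)$ (extended linearly), on which the functions below are well-defined rational functions that are not identically zero, $$\mathrm{reg}_G(Y):=\int_{Y(\mathbb{C})} r_3\left(\frac{x_1+x_2+x_3}{-x_0},\ \frac{x_2+x_3}{-x_1},\ \frac{x_3}{-x_2}\right),$$ where $Y(\mathbb{C})$ is taken via $\sigma$. For $Y$ a line, one may integrate over its closure in $\mathbb{P}^3_{\mathbb{C}}$, which is isomorphic to $\mathbb{P}^1_{\mathbb{C}}$. $\mathbb{R}[3]$ denotes $\mathbb{R}$ placed in degree $-3$, where chains $C^{\mathrm{grp}}_m(2)$ and $Z^2(k,m)$ sit in degree $-m$. So commutativity of the triangle only concerns chains with $m=3$. *)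

(* Defs.v *)
From HB Require Import structures.
From mathcomp Require Import all_boot all_order all_algebra all_field.
From mathcomp Require Import complex.
From mathcomp Require Import all_classical all_reals all_analysis.

Set Implicit Arguments.
Unset Strict Implicit.
Unset Printing Implicit Defensive.

Import Order.TTheory GRing.Theory Num.Theory.
Import numFieldNormedType.Exports.

Local Open Scope ring_scope.
Local Open Scope complex_scope.

Section IntegralR3.
Variable R : realType.
Implicit Types (f : 'rV[R[i]]_2 -> R[i]) (p : R * R).

(* Rational functions on P^1(C) are given as degree-0 homogeneous functions of
   the homogeneous coordinates [X_0 : X_1].  Integrals over P^1(C) are computed
   in the chart X_1 = 1, whose complement is a point; with X_0 = x + iy the
   complex orientation is dx /\ dy. *)
Definition chart p : 'rV[R[i]]_2 := \row_j (if j == 0 then p.1 +i* p.2 else 1).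

Definition log_abs f p : R := ln (complex.Re `|f (chart p)|).

Definition dx (u : R * R -> R) p : R := derive1 (fun s : R => u (s, p.2)) p.1.
Definition dy (u : R * R -> R) p : R := derive1 (fun t : R => u (p.1, t)) p.2.

(* The density of du /\ dw with respect to dx /\ dy. *)
Definition wedge (u w : R * R -> R) p : R := dx u p * dy w p - dy u p * dx w p.

(* kappa times the integral of log|f1| dlog|f2| /\ dlog|f3| over P^1(C).  The
   integral converges absolutely for rational functions, and the zeros and poles
   (where ln and the derivatives take default values) form a null set.  The
   nonzero real kappa is kept as a parameter: its customary value makes the
   integral a sum of values of the Bloch-Wigner dilogarithm. *)
Definition int_r3 (kappa : R) f1 f2 f3 : R :=
  kappa * \int[(lebesgue_measure \x lebesgue_measure)%E]_p
            (log_abs f1 p * wedge (log_abs f2) (log_abs f3) p).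

End IntegralR3.

Section LinearCycles.
Variable k : fieldType.
Implicit Types (v : 'cV[k]_2) (g : 'I_4 -> 'M[k]_2).
Implicit Types (l : 'rV[k]_4 -> k) (Y : {vspace 'rV[k]_4}).

(* A linear subvariety of P^3_k is given by its affine cone, a subspace of the
   space k^4 of homogeneous coordinates x_0, ..., x_3. *)
Definition zero_locus l : {vspace 'rV[k]_4} :=
  lker (linfun (l : 'rV[k]_4 -> k^o)).

Definition hyperplane_H : {vspace 'rV[k]_4} :=
  zero_locus (fun x => \sum_i x 0 i).

Definition face (I : {set 'I_4}) : {vspace 'rV[k]_4} :=
  (\bigcap_(i in I) zero_locus (fun x => x 0%R i))%VS.

(* The face has dimension 3 - #|I| in Delta^3 = P^3 \ H and the cone over Y has
   dimension one more than Y, so codimension >= 2 in the face means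
   \dim (Y :&: face I) - 1 <= 3 - #|I| - 2, unless the intersection is empty
   in Delta^3. *)
Definition meets_faces_properly Y : Prop :=
  forall I : {set 'I_4},
    (Y :&: face I <= hyperplane_H)%VS \/ (\dim (Y :&: face I) + #|I| <= 2)%N.

(* Y is the closure of a line in Delta^3 that is a generator of Z^2(k, 3). *)
Definition is_linear_cycle Y : Prop :=
  [/\ \dim Y = 2%N, ~~ (Y <= hyperplane_H)%VS & meets_faces_properly Y].

Definition general_position g v : Prop :=
  forall i j, i != j -> free [:: g i *m v; g j *m v].

Definition tilde_psi2 g v : {vspace 'rV[k]_4} :=
  lker (linfun (fun x : 'rV[k]_4 => \sum_i x 0 i *: (g i *m v))).

Definition not_identically_zero_on Y l : Prop := exists2 x, x \in Y & l x != 0.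

(* All numerators and denominators of the three functions in reg_G are nonzero
   on Y. *)
Definition reg_G_defined Y : Prop :=
  [/\ is_linear_cycle Y,
      not_identically_zero_on Y (fun x => x 0 1 + x 0 2 + x 0 3) /\
      not_identically_zero_on Y (fun x => - x 0 0),
      not_identically_zero_on Y (fun x => x 0 2 + x 0 3) /\
      not_identically_zero_on Y (fun x => - x 0 1) &
      not_identically_zero_on Y (fun x => x 0 3) /\
      not_identically_zero_on Y (fun x => - x 0 2)].

End LinearCycles.

Section Regulators.
Variables (R : realType) (kappa : R).
Variables (k : fieldExtType rat) (sigma : {rmorphism k -> R[i]}).
Implicit Types (v : 'cV[k]_2) (g : 'I_4 -> 'M[k]_2) (Y : {vspace 'rV[k]_4}).

Definition pairing (X : 'rV[R[i]]_2) (w : 'cV[k]_2) : R[i] :=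
  (X *m map_mx sigma w) 0 0.

Definition reg_B g v : R :=
  let f (i : 'I_4) X := pairing X (g i *m v) / pairing X (g 0 *m v) in
  int_r3 kappa (f 1) (f 2) (f 3).

(* For a line Y, an isomorphism from P^1(C) onto its closure in P^3(C).  The
   basis of the cone is immaterial: another one changes the parametrization by
   an automorphism of P^1, which preserves the integral. *)
Definition parametrization Y (X : 'rV[R[i]]_2) : 'rV[R[i]]_4 :=
  \sum_(j < 2) X 0 j *: map_mx sigma (vbasis Y)`_j.

Definition reg_G Y : R :=
  let x X i := parametrization Y X 0 i in
  int_r3 kappa
    (fun X => (x X 1 + x X 2 + x X 3) / - x X 0)
    (fun X => (x X 2 + x X 3) / - x X 1)
    (fun X => x X 3 / - x X 2).

End Regulators.

(* Main.v *)
(** For k = Q(i), take the directions w_i = g_i v to be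
    (0,1), (-i,-1), (-1,-1), (1,-1).  On Y = { sum_i x_i w_i = 0 } the second
    coordinate of the relation reads x_0 = x_1 + x_2 + x_3, so the first
    function in reg_G has absolute value 1 and reg_G (Y) = 0.  In the chart
    z = X_0 / X_1, the functions in reg_B have absolute values |z - i|,
    |z + 1| and |z - 1|, so reg_B is kappa times the integral over the plane of
    log|z - i|^2 * y / (|z + 1|^2 |z - 1|^2).  Averaging this density with its
    reflection in the real axis replaces log|z - i|^2 by
    (log|z - i|^2 - log|z + i|^2) / 2, whose sign is opposite to that of y, so
    the integral is negative. *)
Require Import Defs.
From HB Require Import structures.
From mathcomp Require Import all_boot all_order all_algebra all_field.
From mathcomp Require Import complex.
From mathcomp Require Import all_classical all_reals all_analysis.
From mathcomp Require Import measurable_realfun ring lra.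

Set Implicit Arguments.
Unset Strict Implicit.
Unset Printing Implicit Defensive.

Import Order.TTheory GRing.Theory Num.Theory.
Import numFieldNormedType.Exports.
Local Open Scope classical_set_scope.
Local Open Scope ring_scope.
Local Open Scope complex_scope.

(** * The field Q(i) and its complex embedding *)

(** The field is Q[X] / (X^2 + 1), and the embedding sends the class of X to i. *)
Lemma gaussian_field (R : realType) :
  exists (k : fieldExtType rat) (sigma : {rmorphism k -> R[i]}) (j : k),
    sigma j = 'i.
Proof.
pose p : {poly rat} := 'X^2 + 1.
have szp : size p = 3%N.
  by rewrite /p size_polyDl size_polyXn // size_poly1.
have irr_p : irreducible_poly p.
  (* In degree 2 or 3, having no rational root is enough for irreducibility; here x^2 + 1 > 0. *)
  apply: cubic_irreducible; first by rewrite szp.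
  move=> x.
  rewrite rootE /p !hornerE gt_eqF // ltr_wpDl // sqr_ge0 //.
have pz0 : root (map_poly (ratr : rat -> R[i]) p) 'i.
  by rewrite rootE /p rmorphD rmorphXn /= map_polyX rmorph1 !hornerE sqr_i addNr.
have nz_p : p != 0 by rewrite -size_poly_eq0 szp.
exists (SubFieldExtType pz0 irr_p), (@subfx_inj _ _ _ _ _).
exists (subfx_root (ratr : {rmorphism rat -> R[i]}) 'i p).
exact: subfx_inj_root.
Qed.

(** * Linear maps and determinants of size 2 *)

(** [zero_locus] and [tilde_psi2] apply [linfun] to plain functions, so their kernels can be read
    off only after linearity is proved. *)
Lemma linfun_linearE (K : fieldType) (aT rT : vectType K) (f : aT -> rT) :
  linear f -> linfun f =1 f.
Proof.
move=> lin_f.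
pose m := GRing.isLinear.Build _ _ _ _ f lin_f.
pose ff : {linear aT -> rT} := HB.pack f m.
exact: (lfunE ff).
Qed.

Lemma det_mx22 (K : comPzRingType) (M : 'M[K]_2) :
  \det M = M 0 0 * M 1 1 - M 0 1 * M 1 0.
Proof.
have lift00 : lift 0 0 = 1 :> 'I_2 by apply/val_inj.
have lift10 : lift 1 0 = 0 :> 'I_2 by apply/val_inj.
rewrite (expand_det_row _ 0) !big_ord_recl big_ord0 addr0 /cofactor !det_mx11.
by rewrite !mxE !lift00 lift10 /= expr0 expr1 mul1r mulN1r mulrN.
Qed.

(** * The four matrices and their line in P^3 *)

Section GaussianTuple.
Variables (k : fieldType) (j : k).

Definition col2 (a b : k) : 'cV[k]_2 := \col_i (if i == 0 then a else b).

Definition dir (i : 'I_4) : 'cV[k]_2 :=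
  nth 0 [:: col2 0 1; col2 (- j) (- 1); col2 (- 1) (- 1); col2 1 (- 1)] i.

(** The first column is [dir i], the image of (1,0). The second serves only to make the matrix
    invertible: (1,0) for the direction (0,1), and (0,1) for the others, whose first entry is
    nonzero. *)
Definition frame (i : 'I_4) : 'M[k]_2 :=
  \matrix_(r, c) if c == 0 then dir i r 0
                 else if i == 0 then (r == 0)%:R else (r != 0)%:R.

Definition base_vector : 'cV[k]_2 := col2 1 0.

Lemma frame_base i : frame i *m base_vector = dir i.
Proof.
apply/colP => r; rewrite mxE big_ord_recl big_ord1 !mxE /=.
by rewrite mulr1 mulr0 addr0.
Qed.

Lemma frame_unit i : j != 0 -> frame i \in unitmx.
Proof.
move=> j0; rewrite unitmxE det_mx22 !mxE /= unitfE.
by case: i => [[|[|[|[]]]]] //= ?; rewrite !mxE /= ?(mulr0, mulr1, mul0r) ?(sub0r, subr0)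
   ?oppr_eq0 ?oner_eq0.
Qed.

Lemma base_vector_neq0 : base_vector != 0.
Proof. by apply/eqP => /colP/(_ 0)/eqP; rewrite !mxE /= oner_eq0. Qed.

Lemma free_pair (u w : 'cV[k]_2) : u 0 0 * w 1 0 != u 1 0 * w 0 0 -> free [:: u; w].
Proof.
move=> duw.
have w0 : w != 0.
  by apply: contraNneq duw => ->; rewrite !mxE !mulr0.
rewrite free_cons seq1_free w0 andbT span_seq1.
apply: contra duw => /vlineP[c ->]; rewrite !mxE; apply/eqP; ring.
Qed.

Hypotheses (jj : j * j = -1) (two_neq0 : (2 : k) != 0).

(** Up to sign, the 2 x 2 minors of the four directions are 1, 2, [j], [j - 1] and [j + 1]. Each of
    the last three divides 2, because 1 = - j^2 and 2 = 1 - j^2. *)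
Lemma root_neq : [/\ j != 0, j - 1 != 0 & j + 1 != 0].
Proof.
have two : (2 : k) = 1 - j * j by rewrite jj; ring.
split; apply: contraNneq two_neq0 => h; apply/eqP; rewrite two.
- have -> : 1 = - (j * j) by rewrite jj opprK.
  by rewrite h mul0r subr0 oppr0.
- have -> : 1 - j * j = - (j - 1) * (j + 1) by ring.
  by rewrite h oppr0 mul0r.
- have -> : 1 - j * j = - (j + 1) * (j - 1) by ring.
  by rewrite h oppr0 mul0r.
Qed.

Lemma general_position_frame : general_position frame base_vector.
Proof.
have [j0 j1 jN1] := root_neq.
move=> i i' ii'; rewrite !frame_base; apply: free_pair.
rewrite -subr_eq0; move: ii'.
case: i => [[|[|[|[|//]]]] hi] //=; case: i' => [[|[|[|[|//]]]] hi'] //= _;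
  rewrite /dir !mxE /= ?mul0r ?mulr0 ?mul1r ?mulr1 ?mulN1r ?mulrN1 ?opprK
    ?oppr0 ?sub0r ?subr0 ?oppr_eq0 ?oner_eq0 // ?add0r ?addr0 ?oppr_eq0
    ?oner_eq0 //.
all: by rewrite // -opprB oppr_eq0 // opprK.
Qed.

Local Notation Y := (tilde_psi2 frame base_vector).

(** The solution of the two relations of [mem_lineP] with x_1 = a and x_2 = b free. *)
Definition line_point (a b : k) : 'rV[k]_4 :=
  \row_i nth 0 [:: (1 + j) * a + 2 * b; a; b; j * a + b] i.

Lemma relation_linear : linear
  (fun x : 'rV[k]_4 => \sum_i x 0 i *: (frame i *m base_vector)).
Proof.
move=> c x y; rewrite scaler_sumr -big_split; apply: eq_bigr => i _.
by rewrite !mxE scalerDl scalerA.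
Qed.

Lemma relationE (x : 'rV[k]_4) :
  \sum_i x 0 i *: (frame i *m base_vector) =
  col2 (x 0 3 - x 0 2 - j * x 0 1) (x 0 0 - x 0 1 - x 0 2 - x 0 3).
Proof.
have l1 : lift 0 0 = 1 :> 'I_4 by apply/val_inj.
have l2 : lift 0 (lift 0 0) = 2 :> 'I_4 by apply/val_inj.
have l3 : lift 0 (lift 0 (lift 0 0)) = 3 :> 'I_4 by apply/val_inj.
rewrite !big_ord_recl big_ord0 l1 l2 l3 !frame_base.
by apply/colP => r; rewrite /dir !mxE /=; case: ifP => _; ring.
Qed.

Lemma mem_lineP (x : 'rV[k]_4) : reflect
  (x 0 0 = x 0 1 + x 0 2 + x 0 3 /\ x 0 3 = j * x 0 1 + x 0 2) (x \in Y).
Proof.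
rewrite memv_ker (linfun_linearE relation_linear) relationE.
apply: (iffP eqP) => [/colP h|[h0 h3]].
  have := h 0; have := h 1; rewrite !mxE /= => h1 h0; split; apply/eqP; rewrite -subr_eq0.
    by rewrite -[X in _ == X]h1; apply/eqP; ring.
  by rewrite -[X in _ == X]h0; apply/eqP; ring.
by apply/colP => r; rewrite !mxE h0 h3; case: ifP => _; ring.
Qed.

Lemma line_point_in a b : line_point a b \in Y.
Proof. by apply/mem_lineP; rewrite !mxE /=; split; ring. Qed.

(** Rank-nullity: the relation map from k^4 is onto k^2. *)
Lemma dim_line : \dim Y = 2%N.
Proof.
set f := linfun (fun x : 'rV[k]_4 => \sum_i x 0 i *: (frame i *m base_vector)).
have := limg_ker_dim f fullv; rewrite capfv.
have -> : limg f = fullv.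
  apply/vspaceP => u; rewrite memvf; apply/memv_imgP.
  (* The directions w_0 = (0,1) and w_3 = (1,-1) already span, so x_1 = x_2 = 0 suffices. *)
  exists (\row_i nth 0 [:: u 1 0 + u 0 0; 0; 0; u 0 0] i); first exact: memvf.
  rewrite /f (linfun_linearE relation_linear) relationE; apply/colP => r; rewrite !mxE /=.
  case: ifP => [/eqP -> | /negbT r0]; first by ring.
  have -> : r = 1 by case: r r0 => [[|[|]]] // *; apply/val_inj.
  by ring.
rewrite !dimvf !dim_matrix => h; exact: (@addIn 2 _ 2 h).
Qed.

Lemma zero_locus_mem l (x : 'rV[k]_4) :
  linear (l : 'rV[k]_4 -> k^o) -> (x \in zero_locus l) = (l x == 0).
Proof. by move=> lin_l; rewrite memv_ker (linfun_linearE lin_l). Qed.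

Lemma face_coord (I : {set 'I_4}) i (x : 'rV[k]_4) :
  i \in I -> x \in face k I -> x 0 i = 0.
Proof.
move=> iI /(subvP (bigcapv_inf _ iI (subvv _))).
by rewrite zero_locus_mem => [/eqP //|c u v]; rewrite !mxE.
Qed.

(** Two vanishing coordinates leave a relation between two independent directions. Each case solves
    for x_1 and x_2, dividing where necessary by one of the minors of [root_neq]. *)
Lemma line_vertex (x : 'rV[k]_4) (i i' : 'I_4) : x \in Y ->
  (i < i')%N -> x 0 i = 0 -> x 0 i' = 0 -> x = 0.
Proof.
move=> /mem_lineP[h0 h3] ii' xi xi'; have [j0 j1 jN1] := root_neq.
suff [x1 x2] : x 0 1 = 0 /\ x 0 2 = 0.
  apply/rowP => r; rewrite mxE.
  have x3 : x 0 3 = 0 by rewrite h3 x1 x2 mulr0 addr0.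
  have x0 : x 0 0 = 0 by rewrite h0 x1 x2 x3 !addr0.
  case: r => [[|[|[|[|//]]]] hr];
   [rewrite -[RHS]x0|rewrite -[RHS]x1|rewrite -[RHS]x2|rewrite -[RHS]x3];
   congr (x _ _); exact/val_inj.
have e0 (h : (0 < 4)%N) : x 0 (Ordinal h) = x 0 0 by congr (x _ _); exact/val_inj.
have e1 (h : (1 < 4)%N) : x 0 (Ordinal h) = x 0 1 by congr (x _ _); exact/val_inj.
have e2 (h : (2 < 4)%N) : x 0 (Ordinal h) = x 0 2 by congr (x _ _); exact/val_inj.
have e3 (h : (3 < 4)%N) : x 0 (Ordinal h) = x 0 3 by congr (x _ _); exact/val_inj.
have cancel (c z : k) : c != 0 -> c * z = 0 -> z = 0.
  by move=> c0 /eqP; rewrite mulf_eq0 (negbTE c0) => /eqP.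
rewrite h3 in h0.
case: i ii' xi => [[|[|[|[|//]]]] hi] //=; case: i' xi' => [[|[|[|[|//]]]] hi'] //= + _.
all: rewrite ?e0 ?e1 ?e2 ?e3 // => xi' xi; split=> //.
- apply: (cancel 2) => //; transitivity (x 0 0) => //; rewrite h0 xi'; ring.
- apply: (cancel (j + 1)) => //; transitivity (x 0 0) => //; rewrite h0 xi'; ring.
(* The case x_0 = x_3 = 0: eliminating x_2 gives 2 x_3 - x_0 = (j - 1) x_1. *)
- apply: (cancel (j - 1)) => //; transitivity (2 * x 0 3 - x 0 0).
    by rewrite h0 h3; ring.
  by rewrite xi xi' mulr0 subr0.
- have x1 : x 0 1 = 0.
    apply: (cancel (j - 1)) => //; transitivity (2 * x 0 3 - x 0 0).
      by rewrite h0 h3; ring.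
    by rewrite xi xi' mulr0 subr0.
  by rewrite -xi' h3 x1 mulr0 add0r.
- by rewrite -xi' h3 xi mulr0 add0r.
- by apply: (cancel j) => //; rewrite -xi' h3 xi addr0.
Qed.

Lemma line_cycle : is_linear_cycle Y.
Proof.
have [j0 j1 jN1] := root_neq.
(* The point (j - 1, 1, -1, j - 1) shows that Y lies in no coordinate plane; its coordinate sum 2 (j
   - 1) shows that Y is not in H either. *)
have nz (i : 'I_4) : line_point 1 (-1) 0 i != 0.
  have -> : line_point 1 (-1) 0 i = nth 0 [:: j - 1; 1; -1; j - 1] i.
    by rewrite mxE; case: i => [[|[|[|[|//]]]] hi] /=; ring.
  by case: i => [[|[|[|[|//]]]] hi] //=; rewrite ?oppr_eq0 oner_eq0.
split; first exact: dim_line.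
  apply: contraL (line_point_in 1 (-1)) => /subvP YH; apply/negP => /YH.
  rewrite zero_locus_mem => [|c u v]; last first.
    by rewrite scaler_sumr -big_split; apply: eq_bigr => i _; rewrite !mxE.
  rewrite !big_ord_recl big_ord0 !mxE /=; apply/negP.
  have -> : (1 + j) * 1 + 2 * -1 + (1 + (-1 + (j * 1 + -1 + 0))) = 2 * (j - 1) by ring.
  by rewrite mulf_neq0.
(* A single facet does not contain Y, so the dimension of the cone drops; two or more facets meet
   the cone only in 0. *)
move=> I; have [I_le1|I_gt1] := leqP #|I| 1.
  right; have [I0|[i iI]] := set_0Vmem I.
    by rewrite I0 cards0 addn0 -[leqRHS]dim_line dimvS // capvSl.
  have I1 : #|I| = 1%N.
    by apply/eqP; rewrite eqn_leq I_le1 card_gt0; apply/set0Pn; exists i.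
  rewrite I1 addn1 -[leqRHS]dim_line ltn_neqAle dimvS ?capvSl // andbT.
  apply: contraNneq (nz i) => dimE; apply/eqP/(face_coord iI).
  have := (dimv_leqif_eq (capvSl Y (face k I))).2; rewrite dimE eqxx => /esym/eqP YI.
  by move: (line_point_in 1 (-1)); rewrite -YI memv_cap => /andP[].
left; have /card_gt1P[i [i' [iI i'I ii']]] := I_gt1.
suff -> : (Y :&: face k I)%VS = 0%VS by exact: sub0v.
apply/eqP; rewrite -subv0; apply/subvP => x; rewrite memv_cap memv0 => /andP[xY xI].
have xi := face_coord iI xI; have xi' := face_coord i'I xI.
move: ii'; rewrite neq_lt => /orP[] lt_ii'; apply/eqP.
  exact: (line_vertex xY lt_ii').
exact: (line_vertex xY lt_ii').
Qed.

Lemma line_reg_G_defined : reg_G_defined Y.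
Proof.
have [j0 j1 jN1] := root_neq.
split; first exact: line_cycle.
(* The point (2, 0, 1, 1) serves for every form except x_1, for which (1 + j, 1, 0, j) is taken. *)
- split; [exists (line_point 0 1) | exists (line_point 0 1)];
    rewrite ?line_point_in // !mxE /= ?oppr_eq0 ?mulr0 ?mulr1 ?add0r //.
- split; [exists (line_point 0 1) | exists (line_point 1 0)];
    rewrite ?line_point_in // !mxE /= ?oppr_eq0 ?mulr0 ?mulr1 ?add0r ?oner_eq0 //.
- split; exists (line_point 0 1);
    rewrite ?line_point_in // !mxE /= ?oppr_eq0 ?mulr0 ?mulr1 ?add0r ?oner_eq0 //.
Qed.

End GaussianTuple.

(** * Derivatives of logarithms of quadratic expressions *)

(* If the difference quotient diverges, the default value of [lim] is 0. *)
Lemma derive1_even (R : realType) (f : R -> R) (a : R) :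
  (forall h, f (a - h) = f (a + h)) -> derive1 f a = 0.
Proof.
move=> f_even; rewrite /derive1.
set q := fun h => h^-1 *: (f (h + a) - f a).
have [q_cvg|/dvgP ->//] := pselect (cvg (q h @[h --> 0^'])).
(* The difference quotient is odd in h, so its limit equals its own opposite. *)
have qN : q \o -%R = \- q.
  by apply/funext => h; rewrite /q /= invrN scaleNr [- h + a]addrC f_even [a + h]addrC.
have oppF : (-%R : R -> R) h @[h --> 0^'] --> 0^'.
  move=> A A0; have : nbhs (- 0 : R) [set x | x != 0 -> A x] by rewrite oppr0.
  rewrite nbhsN => AN.
  apply: (@filterS _ (nbhs (0 : R)) _ (fun x => - x != 0 -> A (- x))) => // x Ax x0.
  by apply: Ax; rewrite oppr_eq0.
have [qL qNL] : q h @[h --> 0^'] --> lim (q h @[h --> 0^']) /\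
    (\- q) h @[h --> 0^'] --> lim (q h @[h --> 0^']).
  by split=> //; rewrite -qN; exact: (cvg_comp _ _ oppF q_cvg).
have LN := cvg_unique (@norm_hausdorff _ R) (cvgN qL) qNL.
by apply/eqP; rewrite -[_ == _](mulrn_eq0 _ 2) mulr2n -{1}LN addNr.
Qed.

(* This includes the singular case c = 0, x = a, where ln 0 = 0 and both sides
   are 0. *)
Lemma derive1_ln_sqr (R : realType) (a c x : R) : 0 <= c ->
  derive1 (fun t => ln ((t - a) ^+ 2 + c) / 2) x = (x - a) / ((x - a) ^+ 2 + c).
Proof.
move=> c0; have [ac0|ac0] := eqVneq ((x - a) ^+ 2 + c) 0.
  have /andP[/eqP xa /eqP ->] : ((x - a) ^+ 2 == 0) && (c == 0).
    by rewrite -paddr_eq0 ?sqr_ge0 // ac0.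
  move/eqP: xa; rewrite sqrf_eq0 => /eqP xa; rewrite xa mul0r.
  apply: derive1_even => h.
  move/eqP: xa; rewrite subr_eq0 => /eqP ->; congr (ln _ / _); ring.
have ac_gt0 : 0 < (x - a) ^+ 2 + c by rewrite lt0r ac0 addr_ge0 ?sqr_ge0.
have dsqr : is_derive x (1 : R) (fun t => (t - a) ^+ 2 + c) (2 * (x - a)).
  by apply: is_derive_eq; rewrite /= !subr0 addr0 /GRing.scale /=; ring.
have dln := is_derive1_ln ac_gt0.
have dcomp := @is_derive1_comp _ (@ln R) (fun t => (t - a) ^+ 2 + c) _ _ _ dln dsqr.
have dhalf := is_deriveZ (2^-1 : R) dcomp.
rewrite derive1E (_ : (fun t => _ / 2) =
  2^-1 \*: (@ln R \o (fun t => (t - a) ^+ 2 + c))); last first.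
  by apply/funext => t /=; rewrite /GRing.scale /= mulrC.
by rewrite derive_val /GRing.scale /=; field.
Qed.

(** * Logarithms of distances in the affine chart *)

Section LogDistance.
Variable R : realType.
Implicit Types (a b : R) (p : R * R).

Definition sqr_dist a b p : R := (p.1 - a) ^+ 2 + (p.2 - b) ^+ 2.

(** This is log|f| = log(|f|^2) / 2. It persists at a zero of f, where both logarithms take the
    default value 0. *)
Lemma log_absE a b (f : 'rV[R[i]]_2 -> R[i]) p :
  complex.Re (f (chart p)) ^+ 2 + complex.Im (f (chart p)) ^+ 2 = sqr_dist a b p ->
  log_abs f p = ln (sqr_dist a b p) / 2.
Proof.
move=> fE; rewrite /log_abs normc_def fE /=.
have [-> | r0] := eqVneq (sqr_dist a b p) 0; first by rewrite sqrtr0 ln0 // mul0r.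
have r_gt0 : 0 < sqr_dist a b p by rewrite lt0r r0 addr_ge0 ?sqr_ge0.
rewrite -{2}[sqr_dist a b p]sqr_sqrtr ?(ltW r_gt0) // lnXn ?sqrtr_gt0 //; by field.
Qed.

(** The formula also covers the singular points: at a centre the partial derivatives of its
    logarithm are 0, and so is the quotient by 0 on the right. *)
Lemma wedge_log_dist a b a' b' p :
  wedge (fun p => ln (sqr_dist a b p) / 2) (fun p => ln (sqr_dist a' b' p) / 2) p =
  ((p.1 - a) * (p.2 - b') - (p.2 - b) * (p.1 - a')) /
  (sqr_dist a b p * sqr_dist a' b' p).
Proof.
have swap a1 b1 : (fun t : R => ln (sqr_dist a1 b1 (p.1, t)) / 2) =
    (fun t => ln ((t - b1) ^+ 2 + (p.1 - a1) ^+ 2) / 2).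
  by apply/funext => t; rewrite /sqr_dist addrC.
rewrite /wedge /dx /dy !swap /sqr_dist /= !derive1_ln_sqr ?sqr_ge0 //.
rewrite invfM ![(p.2 - _) ^+ 2 + _]addrC; ring.
Qed.
End LogDistance.

(** * Evaluation of the two regulators *)

Section Regulators.
Variables (R : realType) (kappa : R).
Variables (k : fieldExtType rat) (sigma : {rmorphism k -> R[i]}) (j : k).
Hypothesis sigma_j : sigma j = 'i.

Lemma sqr_j : j * j = -1.
Proof.
by apply: (fmorph_inj sigma); rewrite rmorphM rmorphN1 sigma_j -expr2 sqr_i.
Qed.

Lemma two_neq0 : (2 : k) != 0.
Proof. by rewrite -(fmorph_eq0 sigma) rmorph_nat pnatr_eq0. Qed.

(** The relation holds for each basis vector of the cone and survives [sigma] and complex linear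
    combinations. *)
Lemma parametrization_line (X : 'rV[R[i]]_2) :
  let x := parametrization sigma (tilde_psi2 (frame j) (base_vector k)) X in
  x 0 1 + x 0 2 + x 0 3 = x 0 0.
Proof.
rewrite /parametrization !summxE -!big_split /=; apply: eq_bigr => m _.
rewrite !mxE -!mulrDr -!rmorphD; congr (_ * sigma _); apply/esym.
set Y := tilde_psi2 _ _.
have : (vbasis Y)`_m \in Y.
  by rewrite vbasis_mem // mem_nth // size_tuple (dim_line j).
by move=> /(mem_lineP j _)[].
Qed.

Lemma reg_G_line : reg_G kappa sigma (tilde_psi2 (frame j) (base_vector k)) = 0.
Proof.
rewrite /reg_G /int_r3 /Rintegral (eq_integral (cst 0%E)) => [|p _].
  by rewrite integral0 mulr0.
rewrite /log_abs parametrization_line.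
set z := parametrization _ _ _ _ _.
(* Where x_0 = 0 the quotient is 0 and [ln] gives 0 by default; elsewhere the quotient is -1. *)
have [->|z0] := eqVneq z 0; first by rewrite mul0r normr0 ln0 // mul0r.
by rewrite invrN mulrN divff // normrN1 ln1 mul0r.
Qed.

Definition density (p : R * R) : R :=
  ln (sqr_dist 0 1 p) * p.2 / (sqr_dist (-1) 0 p * sqr_dist 1 0 p).

Lemma pairing_chart p (a b : k) :
  pairing sigma (chart p) (col2 a b) = (p.1 +i* p.2) * sigma a + sigma b.
Proof.
by rewrite /pairing mxE big_ord_recl big_ord1 !mxE /= mul1r.
Qed.

Lemma reg_B_frame : reg_B kappa sigma (frame j) (base_vector k) =
  kappa * (\int[(lebesgue_measure \x lebesgue_measure)%E]_p density p)%R.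
Proof.
rewrite /reg_B /int_r3; congr (_ * _); apply: eq_Rintegral => p _.
pose f (i : 'I_4) X := pairing sigma X (frame j i *m base_vector k) /
  pairing sigma X (frame j 0 *m base_vector k).
rewrite -/(f 1) -/(f 2) -/(f 3).
(* The direction (0,1) puts the common pole at infinity: the denominator is X_1, which is 1 in the
   chart. *)
have fE i q : f i (chart q) = pairing sigma (chart q) (dir j i).
  by rewrite /f !frame_base pairing_chart rmorph0 rmorph1 mulr0 add0r divr1.
have f1 : log_abs (f 1) = fun q => ln (sqr_dist 0 1 q) / 2.
  apply/funext => q; apply: log_absE.
  rewrite fE /dir /= pairing_chart !rmorphN rmorph1 sigma_j /sqr_dist /=; ring.
have f2 : log_abs (f 2) = fun q => ln (sqr_dist (-1) 0 q) / 2.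
  apply/funext => q; apply: log_absE.
  rewrite fE /dir /= pairing_chart !rmorphN rmorph1 /sqr_dist /=; ring.
have f3 : log_abs (f 3) = fun q => ln (sqr_dist 1 0 q) / 2.
  apply/funext => q; apply: log_absE.
  rewrite fE /dir /= pairing_chart !rmorphN rmorph1 /sqr_dist /=; ring.
(* The numerator of the wedge is (x + 1) y - y (x - 1) = 2 y, and this 2 cancels the half of the
   remaining logarithm. *)
rewrite f1 f2 f3 wedge_log_dist /density mulrA; congr (_ / _); by field.
Qed.
End Regulators.

(** * Reflections and translations in Lebesgue integrals *)

Section LebesgueInvariance.
Variable R : realType.
Local Notation mu := (@lebesgue_measure R).

(** The image measure under [phi] agrees with Lebesgue measure on half-open intervals, hence
    everywhere by uniqueness; the rest is the change of variables for an image measure. *)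
Lemma ge0_integral_lebesgue_invariant (phi : R -> R) (f : R -> \bar R) :
  measurable_fun setT phi ->
  (forall a b, a < b -> mu (phi @^-1` `]a, b]) = mu `]a, b]) ->
  measurable_fun setT f -> (forall x, (0 <= f x)%E) ->
  (\int[mu]_x f (phi x) = \int[mu]_x f x)%E.
Proof.
move=> mphi phiE mf f0.
pose phi' : measurableTypeR R -> measurableTypeR R := phi.
pose image_measure : {measure set (measurableTypeR R) -> \bar R} := pushforward mu phi'.
pose nu := image_measure mphi.
have nuE (A : set (measurableTypeR R)) : measurable A -> mu A = nu A.
  apply: lebesgue_measure_unique => X /ocitvP[->|[[a b] /= ab ->]].
    by rewrite !measure0.
  by rewrite /nu /pushforward /= phiE.
transitivity (\int[nu]_x f x)%E; last first.
  by apply: eq_measure_integral => A mA _; rewrite -nuE.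
by rewrite (@ge0_integral_pushforward _ _ _ _ _ phi' mphi mu setT f) // preimage_setT.
Qed.

Lemma ge0_integral_oppr (f : R -> \bar R) :
  measurable_fun setT f -> (forall x, (0 <= f x)%E) ->
  (\int[mu]_x f (- x)%R = \int[mu]_x f x)%E.
Proof.
apply: ge0_integral_lebesgue_invariant => // a b ab.
rewrite (_ : _ @^-1` _ = `[(- b)%R, (- a)%R[%classic); last first.
  by apply/seteqP; split=> x /=; rewrite !in_itv /= lerNl ltrNr andbC.
by rewrite !lebesgue_measure_itv /= !lte_fin ltrN2 ab !EFinN oppeK addeC.
Qed.

Lemma ge0_integral_shift (c : R) (f : R -> \bar R) :
  measurable_fun setT f -> (forall x, (0 <= f x)%E) ->
  (\int[mu]_x f (x + c)%R = \int[mu]_x f x)%E.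
Proof.
apply: ge0_integral_lebesgue_invariant => [|a b ab].
  exact: measurable_funD.
rewrite (_ : _ @^-1` _ = `](a - c)%R, (b - c)%R]%classic); last first.
  by apply/seteqP; split=> x /=; rewrite !in_itv /= lerBrDr ltrBlDr.
rewrite !lebesgue_measure_itv /= !lte_fin ltrD2r ab -!EFinB; congr (_%:E); ring.
Qed.

(** On nonnegative reals inversion is the measurable power of exponent -1, even at 0, where both
    give 0. *)
Lemma measurable_funV_ge0 d (T : measurableType d) (D : set T) (g : T -> R) :
  measurable_fun D g -> (forall x, 0 <= g x) ->
  measurable_fun D (fun x => (g x)^-1).
Proof.
move=> mg g0.
rewrite (_ : (fun x => _) = (fun x => g x `^ (-1))); last first.
  by apply/funext => x; rewrite powR_inv1.
exact: (@measurableT_comp _ _ _ _ _ _ (fun y : R => y `^ (-1)) _ g (measurable_powR _) mg).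
Qed.
End LebesgueInvariance.

(** * One-variable kernels with bounded integral *)

Section Kernels.
Variable R : realType.
Local Notation mu := (@lebesgue_measure R).

(** The Poisson kernel of the half-plane at height |y|, multiplied by pi. *)
Definition poisson (y x : R) : R := `|y| / (x ^+ 2 + y ^+ 2).

Lemma poisson_ge0 y x : 0 <= poisson y x.
Proof. by rewrite divr_ge0 // addr_ge0 ?sqr_ge0. Qed.

Lemma measurable_poisson d (T : measurableType d) (f g : T -> R) :
  measurable_fun setT f -> measurable_fun setT g ->
  measurable_fun setT (fun t => poisson (f t) (g t)).
Proof.
move=> mf mg; apply: measurable_funM; first exact: measurableT_comp.
apply: measurable_funV_ge0 => [|t]; last by rewrite addr_ge0 ?sqr_ge0.
by apply: measurable_funD; apply: measurable_funX.
Qed.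

(** By evenness the integral is twice that over x >= 0, where atan (x / |y|) is an antiderivative.
    It equals pi for y != 0, but 0 for y = 0, whence the inequality. *)
Lemma integral_poisson y : (\int[mu]_x (poisson y x)%:E <= pi%:E)%E.
Proof.
have [->|y0] := eqVneq y 0.
  rewrite (eq_integral (cst 0%E)) => [|x _]; last by rewrite /poisson normr0 mul0r.
  by rewrite integral0 lee_fin pi_ge0.
have den_gt0 x : 0 < x ^+ 2 + y ^+ 2 by rewrite ltr_wpDl ?sqr_ge0 // exprn_even_gt0.
have cp : continuous (poisson y).
  move=> x; apply: cvgM; first exact: cvg_cst.
  apply: cvgV; first by rewrite gt_eqF.
  apply: cvgD; last exact: cvg_cst.
  exact: exprn_continuous.
rewrite ge0_symfun_integralT //; last 2 first.
- exact: poisson_ge0.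
- by move=> x; rewrite /poisson /= sqrrN.
rewrite -set_itvcy.
pose F (x : R) := atan (x / `|y|).
have ny_gt0 : 0 < `|y| by rewrite normr_gt0.
have dF (x : R) : is_derive x (1 : R) F (poisson y x).
  have dlin : is_derive x (1 : R) (fun t : R => t / `|y|) (`|y|^-1).
    by apply: is_derive_eq; rewrite scaler0 add0r /GRing.scale /= mulr1.
  have datan := is_derive1_atan (x / `|y|).
  apply: (is_derive_eq (@is_derive1_comp _ (@atan R) (fun t => t / `|y|) _ _ _ datan dlin)).
  rewrite /poisson -(real_normK (num_real y)) /GRing.scale /=; field.
  by rewrite real_normK ?num_real // gt_eqF //= gt_eqF.
rewrite (@ge0_continuous_FTC2y _ (poisson y) F 0 (pi / 2)).
- rewrite /F mul0r atan0 sube0 -EFinM lee_fin; lra.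
- by move=> x _; exact: poisson_ge0.
- exact: continuous_subspaceT.
- apply: (@cvg_comp _ _ _ (fun x => x / `|y|) atan); last exact: cvgy_atan.
  by apply: gt0_cvgMly; rewrite ?invr_gt0.
- by move=> x _; apply: ex_derive.
- apply: cvg_at_right_filter; apply: differentiable_continuous.
  exact/derivable1_diffP/ex_derive.
- by move=> x _; rewrite derive1E; apply: derive_val.
Qed.

(* Vanishes for s <= 0, where [Num.sqrt] is 0; for s > 0 it is the derivative of
   2 arctan (sqrt s). *)
Definition sqrt_kernel (s : R) : R := (Num.sqrt s * (1 + s))^-1.

Lemma sqrt_kernel_ge0 s : 0 <= sqrt_kernel s.
Proof.
have [s0|s0] := leP 0 s; last first.
  by rewrite /sqrt_kernel ler0_sqrtr ?(ltW s0) // mul0r invr0.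
by rewrite invr_ge0 mulr_ge0 ?sqrtr_ge0 // addr_ge0.
Qed.

Lemma measurable_sqrt_kernel : measurable_fun setT sqrt_kernel.
Proof.
(* The absolute value makes the denominator nonnegative everywhere and changes nothing for s < 0,
   where the root is 0. *)
rewrite (_ : sqrt_kernel = fun s => (Num.sqrt s * (1 + `|s|))^-1).
  apply: measurable_funV_ge0 => [|s]; last by rewrite mulr_ge0 ?sqrtr_ge0 ?addr_ge0.
  apply: measurable_funM; first by apply: continuous_measurable_fun; exact: sqrt_continuous.
  exact: measurable_funD.
apply/funext => s; rewrite /sqrt_kernel; have [s0|s0] := leP 0 s; first by rewrite ger0_norm.
by rewrite ler0_sqrtr ?(ltW s0) // !mul0r.
Qed.

(** The kernel is unbounded near 0, so the fundamental theorem is applied from e > 0 on, with a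
    bound independent of e. *)
Lemma integral_sqrt_kernel_tail (e : R) : 0 < e ->
  (\int[mu]_(s in `[e, +oo[) (sqrt_kernel s)%:E <= pi%:E)%E.
Proof.
move=> e0; pose F (s : R) := 2 * atan (Num.sqrt s).
have dF (s : R) : 0 < s -> is_derive s (1 : R) F (sqrt_kernel s).
  move=> s0.
  have datan := is_derive1_atan (Num.sqrt s).
  have d1 := @is_derive1_comp _ (@atan R) Num.sqrt _ _ _ datan (is_derive1_sqrt s0).
  apply: (is_derive_eq (is_deriveZ (2 : R) d1)).
  rewrite sqr_sqrtr ?ltW // /sqrt_kernel /GRing.scale /=; field.
  by rewrite sqrtr_eq0 -ltNge s0 /= gt_eqF // addr_gt0.
have cF s : 0 < s -> {for s, continuous sqrt_kernel}.
  move=> s0; apply: cvgV; first by rewrite gt_eqF // mulr_gt0 ?sqrtr_gt0 ?addr_gt0.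
  apply: cvgM; first exact: sqrt_continuous.
  by apply: cvgD; [exact: cvg_cst | exact: cvg_id].
rewrite (@ge0_continuous_FTC2y _ sqrt_kernel F e pi).
- rewrite -EFinB lee_fin gerBl mulr_ge0 // -(@atan0 R); apply: le_atan.
  exact: sqrtr_ge0.
- by move=> s _; exact: sqrt_kernel_ge0.
- apply: continuous_in_subspaceT => s; rewrite inE /= in_itv /= andbT => es.
  by apply: cF; exact: lt_le_trans es.
- have -> : pi = 2 * (pi / 2) :> R by field.
  rewrite /F; apply: cvgMl_tmp.
  apply: (@cvg_comp _ _ _ Num.sqrt atan); last exact: cvgy_atan.
  apply/cvgryPge => B; near=> s.
  have sB : B ^+ 2 <= s by near: s; apply: nbhs_pinfty_ge; exact: num_real.
  by rewrite (le_trans (ler_norm B)) // -sqrtr_sqr ler_wsqrtr.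
- by move=> s es; apply: ex_derive; apply: dF; exact: lt_trans es.
- apply: cvg_at_right_filter; apply: differentiable_continuous.
  by apply/derivable1_diffP; apply: ex_derive; apply: dF.
- move=> s; rewrite in_itv /= andbT => es; rewrite derive1E; apply: derive_val.
  by apply: dF; exact: lt_trans es.
Unshelve. all: by end_near. Qed.

(** Monotone convergence along the half-lines [1/(n+1), +oo[, which exhaust the set where the kernel
    is nonzero. *)
Lemma integral_sqrt_kernel : (\int[mu]_s (sqrt_kernel s)%:E <= pi%:E)%E.
Proof.
pose A (n : nat) : set (measurableTypeR R) := `[n.+1%:R^-1, +oo[%classic.
have mK (D : set R) : measurable_fun D (EFin \o sqrt_kernel).
  apply/measurable_funTS/measurable_EFinP; exact: measurable_sqrt_kernel.
have -> : (\int[mu]_s (sqrt_kernel s)%:E = \int[mu]_(s in \bigcup_n A n) (sqrt_kernel s)%:E)%E.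
  rewrite [RHS]integral_mkcond; apply: eq_integral => s _.
  rewrite patchE; case: ifPn => //; rewrite notin_setE /= => sA.
  rewrite /sqrt_kernel ler0_sqrtr ?mul0r ?invr0 // leNgt; apply/negP => s0.
  have [n] := ltr_add_invr s0; rewrite add0r => /ltW ns.
  by apply: sA; exists n; rewrite /A /= ?in_itv /= ?ns.
have cvgA : (\int[mu]_(s in A n) (sqrt_kernel s)%:E)%E @[n --> \oo] -->
    (\int[mu]_(s in \bigcup_n A n) (sqrt_kernel s)%:E)%E.
  apply: ge0_nondecreasing_set_cvg_integral => [m n mn|n|n|n s _].
  - apply/subsetPset => s; rewrite /A /= !in_itv /= !andbT; apply: le_trans.
    by rewrite lef_pV2 ?posrE // ler_nat.
  - exact: measurable_itv.
  - exact: mK.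
  - by rewrite lee_fin sqrt_kernel_ge0.
rewrite -(cvg_lim _ cvgA) //; apply: lime_le; first by apply/cvg_ex; eexists; exact: cvgA.
by apply: nearW => n; apply: integral_sqrt_kernel_tail; rewrite invr_gt0.
Qed.
End Kernels.

(** * Pointwise domination of the density *)

Section Domination.
Variable R : realType.

(* With t = r^(1/4), |ln r| = 4 |ln t| <= 4 max (t, 1/t) while
   sqrt s <= t. *)
Lemma log_bound (s r : R) : 0 < s -> s ^+ 2 <= r ->
  `|ln r| * (Num.sqrt s * (1 + s)) <= 8 * (1 + r).
Proof.
move=> s0 sr; have r0 : 0 < r by apply: lt_le_trans sr; rewrite exprn_gt0.
set u := Num.sqrt s; pose t := Num.sqrt (Num.sqrt r).
have u0 : 0 < u by rewrite sqrtr_gt0.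
have t0 : 0 < t by rewrite !sqrtr_gt0.
have su : s = u ^+ 2 by rewrite sqr_sqrtr // ltW.
have rt : r = t ^+ 4.
  by rewrite (exprM t 2 2) sqr_sqrtr ?sqrtr_ge0 // sqr_sqrtr // ltW.
have ut : u <= t.
  by rewrite ler_wsqrtr // -(ger0_norm (ltW s0)) -sqrtr_sqr ler_wsqrtr.
have -> : ln r = 4 * ln t by rewrite rt lnXn // mulr_natl.
rewrite normrM (ger0_norm (ler0n _ 4)).
have ut3 : u * (1 + s) <= t * (1 + t ^+ 2).
  rewrite su ler_pM ?(ltW u0) ?addr_ge0 ?sqr_ge0 // lerD2l.
  by apply: lerXn2r => //; rewrite nnegrE ltW.
have us0 : 0 <= u * (1 + s) by rewrite mulr_ge0 ?addr_ge0 ?ltW.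
(* For t >= 1 the product is at most 4 t * 2 t^3 = 8 r; for t < 1 it is at most (4 / t) * 2 t =
   8. *)
have [t1|t1] := leP 1 t.
  have lnt : `|ln t| <= t by rewrite ger0_norm ?ln_ge0 // ltW // ln_sublinear.
  have t13 : t <= t ^+ 3 by rewrite ler_eXnr.
  apply: (@le_trans _ _ (4 * t * (2 * t ^+ 3))).
    apply: ler_pM => //.
      by rewrite ler_pM2l.
    by apply: (le_trans ut3); rewrite mulrDr mulr1 -exprS; lra.
  by rewrite rt; have := exprn_ge0 4 (ltW t0); rewrite !exprS expr0; nra.
have lnt : `|ln t| <= t^-1.
  rewrite ler0_norm ?ln_le0 ?(ltW t1) // -lnV ?posrE // ltW // ln_sublinear //.
  by rewrite invr_gt0.
apply: (@le_trans _ _ (4 * t^-1 * (2 * t))).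
  apply: ler_pM => //.
    by rewrite ler_pM2l.
  apply: (le_trans ut3); have t2 : t ^+ 2 <= 1 by rewrite expr_le1 ?ltW.
  by rewrite mulrC ler_pM2r //; lra.
rewrite (_ : 4 / t * (2 * t) = 8); last by field; rewrite gt_eqF.
lra.
Qed.

(* The Poisson kernels come from 1 / (A B) = (1 / A + 1 / B) / (A + B) for
   A = |z + 1|^2 and B = |z - 1|^2; their integral over x is at most pi for
   every y. *)
Definition dominant (p : R * R) : R :=
  12 * (sqrt_kernel (p.2 - 1) + sqrt_kernel (1 - p.2)) *
  (poisson p.2 (p.1 + 1) + poisson p.2 (p.1 + -1)).

(** [log_bound] is applied with s = |y - 1| and r = |z - i|^2, which requires y != 1 for s to be
    positive. *)
Lemma density_le_dominant p : p.2 != 1 -> `|density p| <= dominant p.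
Proof.
case: p => x y /= y1; rewrite /density /dominant /sqr_dist /=.
set A := (x - -1) ^+ 2 + _; set B := (x - 1) ^+ 2 + _.
set r := (x - 0) ^+ 2 + _.
have PA : poisson y (x + 1) = `|y| / A by rewrite /A /poisson opprK subr0.
have PB : poisson y (x + -1) = `|y| / B by rewrite /B /poisson subr0.
rewrite PA PB.
have K0 : 0 <= sqrt_kernel (y - 1) + sqrt_kernel (1 - y).
  by rewrite addr_ge0 ?sqrt_kernel_ge0.
have [->|y0] := eqVneq y 0; first by rewrite mulr0 !mul0r normr0 !mul0r addr0 mulr0.
have y2 : 0 < (y - 0) ^+ 2 by rewrite subr0 exprn_even_gt0.
have A0 : 0 < A by rewrite ltr_wpDl ?sqr_ge0.
have B0 : 0 < B by rewrite ltr_wpDl ?sqr_ge0.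
have s0 : 0 < `|y - 1| by rewrite normr_gt0 subr_eq0.
have sr : `|y - 1| ^+ 2 <= r by rewrite real_normK ?num_real // lerDr sqr_ge0.
have K : sqrt_kernel `|y - 1| <= sqrt_kernel (y - 1) + sqrt_kernel (1 - y).
  have [h|h] := leP 0 (y - 1).
    by rewrite ger0_norm // lerDl sqrt_kernel_ge0.
  by rewrite ltr0_norm // opprB lerDr sqrt_kernel_ge0.
have lnr : `|ln r| <= 8 * (1 + r) * sqrt_kernel `|y - 1|.
  by rewrite /sqrt_kernel ler_pdivlMr ?log_bound // mulr_gt0 ?sqrtr_gt0 ?addr_gt0.
(* Here A + B = 2 (x^2 + y^2 + 1), and 1 + r <= 3 (x^2 + y^2 + 1) because - 2 y <= y^2 + 1. *)
have rAB : 8 * (1 + r) <= 12 * (A + B) by rewrite /r /A /B; nra.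
rewrite normrM normrM normfV (gtr0_norm (mulr_gt0 A0 B0)).
rewrite (_ : _ * (`|y| / A + `|y| / B) = 12 * (A + B) *
   (sqrt_kernel (y - 1) + sqrt_kernel (1 - y)) * (`|y| / (A * B))); last first.
  by field; rewrite !gt_eqF.
rewrite -mulrA ler_wpM2r ?divr_ge0 ?mulr_ge0 ?(ltW A0) ?(ltW B0) //.
apply: (le_trans lnr); apply: ler_pM => //; last exact: sqrt_kernel_ge0.
by rewrite mulr_ge0 // addr_ge0 // (le_trans _ sr) ?sqr_ge0.
Qed.

End Domination.

(** * Integrability of the density on the plane *)

Section DensityIntegral.
Variable R : realType.
Local Notation mu := (@lebesgue_measure R).
Local Notation mu2 := (mu \x mu)%E.
Local Notation plane := (measurableTypeR R * measurableTypeR R)%type.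

Lemma measurable_sqr_dist (a b : R) : measurable_fun setT (sqr_dist a b : plane -> R).
Proof. by apply: measurable_funD; apply: measurable_funX; apply: measurable_funB. Qed.

Lemma measurable_density : measurable_fun setT (@density R : plane -> R).
Proof.
apply: measurable_funM.
  apply: measurable_funM; last exact: measurable_snd.
  apply: measurableT_comp; first exact: measurable_ln.
  exact: measurable_sqr_dist.
apply: measurable_funV_ge0 => [|p]; last by rewrite mulr_ge0 // addr_ge0 ?sqr_ge0.
by apply: measurable_funM; exact: measurable_sqr_dist.
Qed.

Lemma measurable_dominant : measurable_fun setT (@dominant R : plane -> R).
Proof.
have mP (c : R) : measurable_fun setT (fun p : plane => poisson p.2 (p.1 + c)).
  by apply: measurable_poisson => //; exact: measurable_funD.
apply: measurable_funM; last exact: measurable_funD.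
apply: measurable_funM => //.
by apply: measurable_funD; apply: measurableT_comp;
  [exact: measurable_sqrt_kernel | exact: measurable_funB
  |exact: measurable_sqrt_kernel | exact: measurable_funB].
Qed.

Lemma dominant_ge0 p : 0 <= @dominant R p.
Proof.
by rewrite !mulr_ge0 ?addr_ge0 ?sqrt_kernel_ge0 ?poisson_ge0.
Qed.

(** By Tonelli with x innermost: for fixed y the two Poisson kernels contribute at most 2 pi, and
    the remaining two functions of y have integral at most pi each. *)
Lemma integrable_dominant : mu2.-integrable setT (EFin \o @dominant R).
Proof.
have mD : measurable_fun setT (EFin \o @dominant R : plane -> \bar R).
  by apply/measurable_EFinP; exact: measurable_dominant.
apply/integrable21ltyP => //.
pose c (y : R) : R := 12 * (sqrt_kernel (y - 1) + sqrt_kernel (1 - y)).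
have c0 y : 0 <= c y by rewrite mulr_ge0 ?addr_ge0 ?sqrt_kernel_ge0.
have mK1 : measurable_fun setT (fun y : R => (sqrt_kernel (y - 1))%:E).
  apply/measurable_EFinP; apply: measurableT_comp; first exact: measurable_sqrt_kernel.
  exact: measurable_funB.
have mK2 : measurable_fun setT (fun y : R => (sqrt_kernel (1 - y))%:E).
  apply/measurable_EFinP; apply: measurableT_comp; first exact: measurable_sqrt_kernel.
  exact: measurable_funB.
have mK : measurable_fun setT (EFin \o @sqrt_kernel R).
  by apply/measurable_EFinP; exact: measurable_sqrt_kernel.
have mP y : measurable_fun setT (fun x : R => (poisson y x)%:E).
  by apply/measurable_EFinP; exact: measurable_poisson.
have mPc y (a : R) : measurable_fun setT (fun x : R => (poisson y (x + a))%:E).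
  by apply/measurable_EFinP; apply: measurable_poisson => //; exact: measurable_funD.
have P0 (y x : R) : (0 <= (poisson y x)%:E)%E by rewrite lee_fin poisson_ge0.
have K0 s : (0 <= (@sqrt_kernel R s)%:E)%E by rewrite lee_fin sqrt_kernel_ge0.
have inner y : (\int[mu]_x `|(EFin \o @dominant R) (x, y)| <= (c y)%:E * (2 * pi)%:E)%E.
  have -> : (\int[mu]_x `|(EFin \o @dominant R) (x, y)| = \int[mu]_x ((c y)%:E *
      ((poisson y (x + 1))%:E + (poisson y (x + -1))%:E)))%E.
    by apply: eq_integral => x _; rewrite /= ger0_norm ?dominant_ge0.
  rewrite ge0_integralZl //; last 3 first.
  - by apply: emeasurable_funD; exact: mPc.
  - by move=> x _; rewrite adde_ge0.
  - by rewrite lee_fin c0.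
  have [mP1 mP2] := (mPc y 1, mPc y (-1)).
  rewrite ge0_integralD //; apply: lee_wpmul2l; first by rewrite lee_fin.
  rewrite !(ge0_integral_shift _ (mP y)) // mulr_natl mulr2n EFinD.
  by rewrite leeD // integral_poisson.
apply: (@le_lt_trans _ _ (\int[mu]_y ((c y)%:E * (2 * pi)%:E))%E).
  apply: ge0_le_integral => //.
  - by move=> y _; apply: integral_ge0.
  - have mabs : measurable_fun setT (abse \o (EFin \o @dominant R) : plane -> \bar R).
      exact: measurableT_comp.
    by apply: (@measurable_fun_fubini_tonelli_G _ _ (measurableTypeR R)
      (measurableTypeR R) R mu _ mabs) => p /=.
  - apply/measurable_EFinP; apply: measurable_funM => //; apply: measurable_funM => //.
    by apply: measurable_funD; apply/measurable_EFinP.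
have -> : (\int[mu]_y ((c y)%:E * (2 * pi)%:E) =
    (12 * (2 * pi))%:E * \int[mu]_y ((sqrt_kernel (y - 1))%:E + (sqrt_kernel (1 - y))%:E))%E.
  rewrite -ge0_integralZl //; last 3 first.
  - exact: emeasurable_funD.
  - by move=> x _; rewrite adde_ge0.
  - by rewrite lee_fin !mulr_ge0 // pi_ge0.
  apply: eq_integral => y _; rewrite -!EFinD -!EFinM /c; congr (_%:E); ring.
rewrite ge0_integralD // (ge0_integral_shift (-1) mK) //.
(* Since 1 - y = - (y - 1), a translation and a reflection suffice. *)
have -> : (\int[mu]_y (sqrt_kernel (1 - y))%:E = \int[mu]_y (@sqrt_kernel R y)%:E)%E.
  have mN : measurable_fun setT (fun y : R => (sqrt_kernel (- y))%:E).
    by apply/measurable_EFinP; apply: measurableT_comp; first exact: measurable_sqrt_kernel.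
  transitivity (\int[mu]_y (@sqrt_kernel R (- y))%:E)%E; last exact: (ge0_integral_oppr mK).
  rewrite -[RHS](ge0_integral_shift (-1) mN) //.
  by apply: eq_integral => y _; rewrite opprD opprK addrC.
apply: (@le_lt_trans _ _ ((12 * (2 * pi))%:E * (pi%:E + pi%:E))%E); last first.
  by rewrite -EFinD -EFinM ltry.
apply: lee_wpmul2l; first by rewrite lee_fin !mulr_ge0 ?pi_ge0.
by rewrite leeD // integral_sqrt_kernel.
Qed.

Lemma horizontal_lineE (b : R) : [set p : plane | p.2 = b] = setT `*` [set b].
Proof. by apply/seteqP; split=> -[x y] //= []. Qed.

Lemma horizontal_line_null (b : R) : mu2 [set p : plane | p.2 = b] = 0%E.
Proof.
rewrite horizontal_lineE product_measure1E //.
transitivity (mu setT * 0)%E; last exact: mule0.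
by congr (_ * _)%E; exact: lebesgue_measure_set1.
Qed.

(** On the line y = 1 [dominant] vanishes, as [sqrt_kernel] is 0 at 0, and cannot bound the density;
    this null line is removed before the comparison. *)
Lemma integrable_density : mu2.-integrable setT (EFin \o @density R).
Proof.
have mline : measurable [set p : plane | p.2 = 1].
  by rewrite horizontal_lineE; exact: measurableX.
have mf : measurable_fun setT (EFin \o @density R : plane -> \bar R).
  by apply/measurable_EFinP; exact: measurable_density.
apply/(negligible_integrable mline measurableT mf (horizontal_line_null 1)).
have mD := measurableD measurableT mline.
have iD := integrableS measurableT mD (@subsetT _ _) integrable_dominant.
apply: (le_integrable mD _ _ iD); first exact: measurable_funTS.
move=> p [_ /= /eqP p1]; rewrite lee_fin (ger0_norm (dominant_ge0 p)).
exact: density_le_dominant.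
Qed.

End DensityIntegral.

(** * Folding along the real axis and the sign of the integral *)

Section Reflection.
Variable R : realType.
Local Notation mu := (@lebesgue_measure R).
Local Notation mu2 := (mu \x mu)%E.
Local Notation plane := (measurableTypeR R * measurableTypeR R)%type.

Definition reflection (p : plane) : plane := (p.1, - p.2).

Lemma measurable_reflection : measurable_fun setT reflection.
Proof.
have mN : measurable_fun setT (fun p : plane => - p.2).
  exact: (@measurableT_comp _ _ _ _ _ _ (-%R : R -> R) _ snd).
by apply/measurable_fun_pairP; split; [exact: measurable_fst | exact: mN].
Qed.

(** Tonelli reduces this to the reflection of the inner integral over y. *)
Lemma ge0_integral_reflection (f : plane -> \bar R) :
  measurable_fun setT f -> (forall p, (0 <= f p)%E) ->
  (\int[mu2]_p f (reflection p) = \int[mu2]_p f p)%E.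
Proof.
move=> mf f0.
have mfr : measurable_fun setT (f \o reflection).
  exact: measurableT_comp measurable_reflection.
rewrite (fubini_tonelli1 f mf f0) (fubini_tonelli1 (f \o reflection) mfr) => [|p]; last exact: f0.
apply: eq_integral => x _; rewrite /fubini_F /=.
by apply: (ge0_integral_oppr (f := fun y => f (x, y))) => //;
  exact: measurableT_comp mf (pair1_measurable x).
Qed.

Lemma integrable_reflection (f : plane -> \bar R) :
  mu2.-integrable setT f -> mu2.-integrable setT (f \o reflection).
Proof.
move=> /integrableP[mf ifoo]; apply/integrableP; split.
  exact: measurableT_comp measurable_reflection.
have mabs : measurable_fun setT (abse \o f) by exact: measurableT_comp.
by have := ge0_integral_reflection mabs (fun p => abse_ge0 _) => /= ->.
Qed.

Lemma integral_reflection (f : plane -> \bar R) : measurable_fun setT f ->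
  (\int[mu2]_p f (reflection p) = \int[mu2]_p f p)%E.
Proof.
move=> mf; rewrite integralE [RHS]integralE.
rewrite -/(f \o reflection) -(ge0_integral_reflection (measurable_funepos mf) (funepos_ge0 f)).
rewrite -(ge0_integral_reflection (measurable_funeneg mf) (funeneg_ge0 f)).
congr (_ - _)%E; apply: eq_integral => p _.
  by rewrite funepos_comp.
by rewrite funeneg_comp.
Qed.

Definition folded_density (p : plane) : R := density p + density (reflection p).

(** Reflection turns |z - i| into |z + i| and y into -y, and fixes |z + 1| and |z - 1|. *)
Lemma folded_densityE p : folded_density p =
  (ln (sqr_dist 0 1 p) - ln (sqr_dist 0 (-1) p)) * p.2 /
  (sqr_dist (-1) 0 p * sqr_dist 1 0 p).
Proof.
rewrite /folded_density /density /reflection /sqr_dist /=.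
rewrite !subr0 sqrrN (_ : (- p.2 - 1) ^+ 2 = (p.2 - -1) ^+ 2); ring.
Qed.

Lemma ln_sqr_dist_le p : 0 <= p.2 ->
  ln (sqr_dist 0 1 p) <= ln (sqr_dist 0 (-1) p) :> R.
Proof.
case: p => x y /= y0; rewrite /sqr_dist /=.
(* At z = i the left logarithm is 0 by default, so the right one must be shown nonnegative;
   elsewhere z is no farther from i than from -i. *)
have le1 : 1 <= (x - 0) ^+ 2 + (y - -1) ^+ 2 by nra.
have [->|r0] := eqVneq ((x - 0) ^+ 2 + (y - 1) ^+ 2) 0; first by rewrite ln0 // ln_ge0.
rewrite ler_ln ?posrE; first by nra.
- by rewrite lt0r r0 addr_ge0 ?sqr_ge0.
- exact: lt_le_trans le1.
Qed.

Lemma folded_density_le0 p : folded_density p <= 0.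
Proof.
wlog p0 : p / 0 <= p.2.
  move=> wlog_ge0; have [|p0] := leP 0 p.2; first exact: wlog_ge0.
  have -> : folded_density p = folded_density (reflection p).
    by rewrite /folded_density /reflection /= opprK -surjective_pairing addrC.
  by apply: wlog_ge0; rewrite /= oppr_ge0 ltW.
rewrite folded_densityE mulr_le0_ge0 ?invr_ge0 ?mulr_ge0 ?addr_ge0 ?sqr_ge0 //.
by rewrite mulr_le0_ge0 // subr_le0 ln_sqr_dist_le.
Qed.

(** The half-plane y > 1 avoids i, 1 and -1, so the logarithms take no default value and the
    denominator is positive. *)
Lemma folded_density_lt0 p : 1 < p.2 -> folded_density p < 0.
Proof.
move=> p1; have p0 : 0 < p.2 by exact: lt_trans p1.
have p2 : 0 < (p.2 - 0) ^+ 2 by rewrite subr0 exprn_gt0.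
have den_gt0 : 0 < sqr_dist (-1) 0 p * sqr_dist 1 0 p.
  by apply: mulr_gt0; rewrite /sqr_dist ltr_wpDl ?sqr_ge0.
rewrite folded_densityE -mulrA nmulr_rlt0; first by rewrite divr_gt0.
rewrite subr_lt0.
case: p p1 p0 {p2 den_gt0} => x y /= y1 y0; rewrite /sqr_dist /= ltr_ln ?posrE; first by nra.
- by rewrite ltr_wpDl ?sqr_ge0 // exprn_gt0 // subr_gt0.
- by rewrite ltr_wpDl ?sqr_ge0 // exprn_gt0 // opprK addr_gt0.
Qed.

(** A zero integral would make the folded density, which is nowhere positive, vanish almost
    everywhere, yet it is negative on the box [0,1] x [2,3] of positive measure. *)
Lemma Rintegral_density_neq0 : (\int[mu2]_p (density p : R))%R != 0.
Proof.
apply/eqP => int0.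
have iD := integrable_density R.
have mD : measurable_fun setT (EFin \o @density R : plane -> \bar R).
  by apply/measurable_EFinP; exact: measurable_density.
have intE0 : (\int[mu2]_p (density p : R)%:E = 0)%E.
  (* The real integral is also 0 when the extended one is infinite; integrability excludes this. *)
  move: int0; rewrite /Rintegral => /eqP; rewrite fine_eq0 => [/eqP //|].
  exact: integrable_fin_num.
have iDr := integrable_reflection iD.
have fold0 : (\int[mu2]_p (folded_density p)%:E = 0)%E.
  transitivity (\int[mu2]_p ((density p)%:E + (density (reflection p))%:E))%E.
    by apply: eq_integral => p _; rewrite EFinD.
  rewrite integralD //.
  by rewrite (integral_reflection mD) intE0 adde0.
have mF : measurable_fun setT (EFin \o folded_density).
  apply/measurable_EFinP; apply: measurable_funD; first exact: measurable_density.
  by apply: measurableT_comp; [exact: measurable_density|exact: measurable_reflection].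
have iF : mu2.-integrable setT (EFin \o folded_density).
  have := integrableD measurableT iD iDr; apply: eq_integrable => // p _.
have abs0 : (\int[mu2]_p `|(EFin \o folded_density) p| = 0)%E.
  transitivity (- \int[mu2]_p (folded_density p)%:E)%E; last by rewrite fold0 oppe0.
  rewrite -[RHS]mulN1e -integralZl //.
    apply: eq_integral => p _.
    by rewrite -EFinM mulN1r /= ler0_norm ?folded_density_le0.
have := (ae_eq_integral_abs mu2 measurableT mF).1 abs0.
move=> [N [mN N0 subN]].
pose box : set plane := `[0, 1] `*` `[2, 3].
have mbox : measurable box by exact: measurableX.
have : (mu2 box <= mu2 N)%E.
  apply: le_measure; rewrite ?inE // => p [_ /=]; rewrite in_itv /= => /andP[p2 _].
  apply: subN => /(_ I) /=; case => f0.
  have := @folded_density_lt0 p; rewrite f0 ltxx => h.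
  by suff : false by []; apply: h; apply: lt_le_trans p2; rewrite ltr1n.
rewrite N0 product_measure1E // leNgt => /negP; apply.
have mu01 : (0 < mu `[0%R, 1%R])%E by rewrite lebesgue_measure_itv /= lte01 -EFinD lte_fin subr0.
have mu23 : (0 < mu `[2%R, 3%R])%E.
  by rewrite lebesgue_measure_itv /= lte_fin ltr_nat /= -EFinD lte_fin subr_gt0 ltr_nat.
exact: mule_gt0 mu01 mu23.
Qed.
End Reflection.

(** * The counterexample over Q(i) *)

Theorem proposition2 (R : realType) (kappa : R) (kappa_neq0 : kappa != 0) :
  exists (k : fieldExtType rat) (sigma : {rmorphism k -> R[i]})
         (v : 'cV[k]_2) (g : 'I_4 -> 'M[k]_2),
    [/\ v != 0,
        (forall i, g i \in unitmx),
        general_position g v,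
        reg_G_defined (tilde_psi2 g v) &
        reg_G kappa sigma (tilde_psi2 g v) <> reg_B kappa sigma g v].
Proof.
have [k [sigma [j sigma_j]]] := gaussian_field R.
have jj := sqr_j sigma_j; have k2 := two_neq0 sigma.
exists k, sigma, (base_vector k), (frame j); split.
- exact: base_vector_neq0.
- by move=> i; apply: frame_unit; have [] := root_neq jj k2.
- exact: general_position_frame.
- exact: line_reg_G_defined.
- rewrite (reg_G_line kappa sigma j) (reg_B_frame kappa sigma_j) => /esym/eqP.
  by rewrite mulf_eq0 (negbTE kappa_neq0) (negbTE (Rintegral_density_neq0 R)).
Qed.
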